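(* Assume countable choice. Then for every natural number $k$, every $(\omega\cdot k)$-decidable proposition is semidecidable.
   Context: We work in homotopy type theory with propositional truncation. Countable choice: for every type family $B:\mathbb N\to\mathcal U$, $(\forall n.\,\|B(n)\|)\to\|\Pi(n:\mathbb N).\,B(n)\|$. A proposition $Q$ is semidecidable if $\exists (s:\mathbb N\to\mathbf 2).\,(Q\leftrightarrow\exists i.\,s_i=1)$. $\mathsf{Brw}$ is the type of Brouwer ordinals, defined as a set-truncated quotient inductive-inductive type simultaneously with a proposition-valued relation $\le$: point constructors $\mathsf{zero}$, $\mathsf{succ}$, and $\mathsf{lim}$ of strictly increasing sequences $f:\mathbb N\to\mathsf{Brw}$ ($\forall n.\,\mathsf{succ}(f_n)\le f_{n+1}$); a path constructor identifying limits of mutually simulating sequences; $\le$ is transitive, proposition-valued, with $\mathsf{zero}$ minimal, $\mathsf{succ}$ monotone, $\mathsf{lim}\,f$ the least upper bound of $f$. $\omega=\mathsf{lim}(\lambda n.\,n)$ and $\omega\cdot k$ is ordinal multiplication. A proposition $P$ is $\alpha$-decidable if $\exists y:\mathsf{Brw}.\,(P\leftrightarrow \alpha\le y)$. *)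

(* Defs.v *)
(** Propositions of HoTT are rendered by [Prop], propositional truncation by
    [inhabited], truncated existence by [exists].  Since Rocq has no quotient
    inductive-inductive types, [Brw] is a structure [Brw_spec]: the point, path
    and order constructors together with the full dependent elimination
    principle and its computation rules, which determine it up to unique
    isomorphism.  Families eliminated into are sets, as [Brw] is set-truncated. *)

From Stdlib Require Import Eqdep_dec Bool.

Set Implicit Arguments.
Unset Strict Implicit.

Definition is_prop (A : Type) : Prop := forall x y : A, x = y.
Definition is_set (A : Type) : Prop := forall (x y : A) (p q : x = y), p = q.

Lemma is_prop_is_set (A : Type) : is_prop A -> is_set A.
Proof.
intros H x y p q.
assert (E : forall r : x = y, r = eq_trans (eq_sym (H x x)) (H x y)).
{ intro r; destruct r; symmetry; apply eq_trans_sym_inv_l. }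
now rewrite (E p), (E q).
Qed.

Definition countable_choice : Prop :=
  forall B : nat -> Type,
    (forall n, inhabited (B n)) -> inhabited (forall n, B n).

Definition semidecidable (Q : Prop) : Prop :=
  exists s : nat -> bool, Q <-> exists i, s i = true.

Record brw_constructors : Type := {
  carrier :> Type;
  le : carrier -> carrier -> Prop;
  zero : carrier;
  succ : carrier -> carrier;
  lim : forall f : nat -> carrier,
    (forall n, le (succ (f n)) (f (S n))) -> carrier;
  bisim : forall f g hf hg,
    (forall k, exists n, le (f k) (g n)) ->
    (forall k, exists n, le (g k) (f n)) ->
    lim (f := f) hf = lim (f := g) hg;
  carrier_set : is_set carrier;
  le_zero : forall x, le zero x;
  le_trans : forall x y z, le x y -> le y z -> le x z;
  le_succ_mono : forall x y, le x y -> le (succ x) (succ y);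
  le_cocone : forall x f hf k, le x (f k) -> le x (lim (f := f) hf);
  le_limiting : forall x f hf, (forall k, le (f k) x) -> le (lim (f := f) hf) x;
  le_prop : forall x y, is_prop (le x y)
}.

Arguments le {b} _ _ : rename.
Arguments zero {b} : rename.
Arguments succ {b} _ : rename.
Arguments lim {b} f _ : rename.
Arguments bisim {b} f g hf hg _ _ : rename.
Arguments carrier_set {b} x y p q : rename.
Arguments le_zero {b} x : rename.
Arguments le_trans {b x y z} _ _ : rename.
Arguments le_succ_mono {b x y} _ : rename.
Arguments le_cocone {b x f} hf k _ : rename.
Arguments le_limiting {b x f} hf _ : rename.
Arguments le_prop {b x y} p q : rename.

Definition increasing (B : brw_constructors) (f : nat -> B) : Prop :=
  forall n, le (succ (f n)) (f (S n)).

Record brw_motive (B : brw_constructors) : Type := {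
  mA :> B -> Type;
  mR : forall x y : B, le x y -> mA x -> mA y -> Prop;
  m_set : forall x, is_set (mA x);
  m_zero : mA zero;
  m_succ : forall x, mA x -> mA (succ x);
  m_lim : forall (f : nat -> B) (hf : increasing f) (f' : forall n, mA (f n)),
    (forall n, mR (hf n) (m_succ (f' n)) (f' (S n))) -> mA (lim f hf);
  m_bisim : forall (f g : nat -> B) (hf : increasing f) (hg : increasing g)
    (f' : forall n, mA (f n)) (g' : forall n, mA (g n)) hf' hg'
    (fg : forall k, exists n, le (f k) (g n))
    (gf : forall k, exists n, le (g k) (f n)),
    (forall k, exists n (p : le (f k) (g n)), mR p (f' k) (g' n)) ->
    (forall k, exists n (p : le (g k) (f n)), mR p (g' k) (f' n)) ->
    eq_rect (lim f hf) mA (@m_lim f hf f' hf') (lim g hg) (bisim f g hf hg fg gf)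
    = @m_lim g hg g' hg';
  m_le_zero : forall x (a : mA x), mR (le_zero x) m_zero a;
  m_le_trans : forall x y z (p : le x y) (q : le y z) a b c,
    mR p a b -> mR q b c -> mR (le_trans p q) a c;
  m_le_succ_mono : forall x y (p : le x y) a b,
    mR p a b -> mR (le_succ_mono p) (m_succ a) (m_succ b);
  m_le_cocone : forall x f (hf : increasing f) k (p : le x (f k)) a f' hf',
    mR p a (f' k) -> mR (le_cocone hf k p) a (@m_lim f hf f' hf');
  m_le_limiting : forall x f (hf : increasing f) (p : forall k, le (f k) x) a f' hf',
    (forall k, mR (p k) (f' k) a) ->
    mR (le_limiting hf p) (@m_lim f hf f' hf') a
}.

Arguments mR {B} M {x y} _ _ _ : rename.
Arguments m_zero {B} M : rename.
Arguments m_succ {B} M {x} _ : rename.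
Arguments m_lim {B} M {f} hf f' _ : rename.

(** The hypothesis [h] of [s_lim] is a statement about
    [m_succ M (s (f n))] rather than [s (succ (f n))]; it always holds by
    [s_le] and [s_succ]. *)
Record brw_section (B : brw_constructors) (M : brw_motive B) : Type := {
  s_fun :> forall x, M x;
  s_le : forall x y (p : le x y), mR M p (s_fun x) (s_fun y);
  s_zero : s_fun zero = m_zero M;
  s_succ : forall x, s_fun (succ x) = m_succ M (s_fun x);
  s_lim : forall f (hf : increasing f) h,
    s_fun (lim f hf) = m_lim M hf (fun n => s_fun (f n)) h
}.

Record Brw_spec : Type := {
  brw :> brw_constructors;
  brw_elim : forall M : brw_motive brw, brw_section M
}.

Lemma brw_ind (B : Brw_spec) (P : B -> Prop) :
  (forall x, is_prop (P x)) ->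
  P zero -> (forall x, P x -> P (succ x)) ->
  (forall f (hf : increasing f), (forall n, P (f n)) -> P (lim f hf)) ->
  forall x, P x.
Proof.
intros Pp Pz Ps Pl.
unshelve refine (s_fun (brw_elim (@Build_brw_motive B P
  (fun _ _ _ _ _ => True) _ Pz Ps (fun f hf f' _ => Pl f hf f') _ _ _ _ _ _)));
  auto.
- intro x; apply is_prop_is_set, Pp.
- intros; apply Pp.
Defined.

Lemma le_refl (B : Brw_spec) (x : B) : le x x.
Proof.
revert x; apply brw_ind.
- intros x p q; apply le_prop.
- apply le_zero.
- intros x; apply le_succ_mono.
- intros f hf H; apply le_limiting; intro k; now apply le_cocone with k.
Qed.

Lemma le_succ_self (B : Brw_spec) (x : B) : le x (succ x).
Proof.
revert x; apply brw_ind.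
- intros x p q; apply le_prop.
- apply le_zero.
- intros x; apply le_succ_mono.
- intros f hf H; apply le_limiting; intro k.
  apply (le_trans (H k)), le_succ_mono, le_cocone with k, le_refl.
Qed.

Lemma is_set_sig (A : Type) (P : A -> Prop) :
  is_set A -> (forall a, is_prop (P a)) -> is_set {a : A | P a}.
Proof.
intros HA HP x y p q.
assert (E : forall (x y : {a | P a}) (r : x = y), r = eq_sig x y
  (proj1_sig_eq r) (HP _ _ _)).
{ intros u v r; destruct r; destruct u as [a h]; cbn.
  generalize (HP a h h); intro e.
  now rewrite (is_prop_is_set (HP a) e eq_refl). }
rewrite (E _ _ p), (E _ _ q).
now rewrite (HA _ _ (proj1_sig_eq p) (proj1_sig_eq q)).
Qed.

(** Monotone recursion with base value [z] and inflationary successor step [s].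
    The values are kept above [z], since [zero] is minimal. *)
Definition rec_motive (B : Brw_spec) (z : B) (s : B -> B)
  (s_mono : forall a b, le a b -> le (s a) (s b))
  (s_infl : forall a, le z a -> le (succ a) (s a)) : brw_motive B.
Proof.
unshelve refine (@Build_brw_motive B (fun _ => {a : B | le z a})
  (fun _ _ _ a b => le (proj1_sig a) (proj1_sig b)) _
  (exist _ z (le_refl z))
  (fun _ a => exist _ (s (proj1_sig a))
     (le_trans (proj2_sig a) (le_trans (le_succ_self _) (s_infl _ (proj2_sig a)))))
  (fun f hf f' hf' =>
     let hl n := le_trans (s_infl _ (proj2_sig (f' n))) (hf' n) in
     exist _ (lim (fun n => proj1_sig (f' n)) hl)
       (le_cocone hl 0 (proj2_sig (f' 0)))) _ _ _ _ _ _).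
- intros _; apply is_set_sig; [apply carrier_set | intro; apply le_prop].
- intros f g hf hg f' g' hf' hg' fg gf Hfg Hgf; cbn.
  rewrite rew_const; apply eq_sig_uncurried; unshelve eexists; cbn.
  + apply bisim; intro k; [destruct (Hfg k) as (n & _ & h)
                          | destruct (Hgf k) as (n & _ & h)]; now exists n.
  + apply le_prop.
- intros x a; exact (proj2_sig a).
- intros x y t p q a b c; cbn; apply le_trans.
- intros x y p a b; cbn; apply s_mono.
- intros x f hf k p a f' hf' h; cbn; now apply le_cocone with k.
- intros x f hf p a f' hf' h; cbn; now apply le_limiting.
Defined.

Definition add_motive (B : Brw_spec) (x : B) : brw_motive B :=
  rec_motive (z := x) (s := succ)
    (fun a b => @le_succ_mono B a b) (fun a _ => le_refl (succ a)).

Definition add (B : Brw_spec) (x y : B) : B :=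
  proj1_sig (brw_elim (add_motive x) y).

Section AddTheory.
Variables (B : Brw_spec) (x : B).

Lemma add_zero : add x zero = x.
Proof. unfold add; now rewrite s_zero. Qed.

Lemma add_succ y : add x (succ y) = succ (add x y).
Proof. unfold add at 1; now rewrite s_succ. Qed.

Lemma le_add2l y y' : le y y' -> le (add x y) (add x y').
Proof. intro p; exact (s_le (brw_elim (add_motive x)) p). Qed.

Lemma add_increasing f : increasing f -> increasing (fun n => add x (f n)).
Proof. intros hf n; rewrite <- add_succ; apply le_add2l, hf. Qed.

Lemma add_lim f (hf : increasing f) :
  add x (lim f hf) = lim (fun n => add x (f n)) (add_increasing hf).
Proof.
unfold add at 1; unshelve erewrite s_lim; cbn.
- exact (add_increasing hf).
- apply bisim; intro k; exists k; apply le_refl.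
Qed.

End AddTheory.

Lemma le_add2r (B : Brw_spec) (a b x : B) : le a b -> le (add a x) (add b x).
Proof.
intro p; revert x; apply brw_ind.
- intros x q r; apply le_prop.
- now rewrite !add_zero.
- intros x; rewrite !add_succ; apply le_succ_mono.
- intros f hf H; rewrite !add_lim; apply le_limiting; intro k.
  now apply le_cocone with k.
Qed.

Lemma le_succ_add (B : Brw_spec) (a x : B) :
  le (succ zero) x -> le (succ a) (add a x).
Proof.
intro p; apply (le_trans (y := add a (succ zero))).
- rewrite add_succ, add_zero; apply le_refl.
- now apply le_add2l.
Qed.

Definition is_zero_motive (B : Brw_spec) : brw_motive B.
Proof.
unshelve refine (@Build_brw_motive B (fun _ => bool)
  (fun _ _ _ a b => b = true -> a = true) _ true (fun _ _ => false)
  (fun _ _ _ _ => false) _ _ _ _ _ _); cbn; auto.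
- intros _ a b p q; apply UIP_dec, bool_dec.
- intros; apply rew_const.
- discriminate.
- intros x f hf p a f' hf' h e.
  now apply (hf' 0), (h 1).
Defined.

Definition is_zero (B : Brw_spec) (x : B) : bool := brw_elim (is_zero_motive B) x.

Lemma is_zeroP (B : Brw_spec) (x : B) :
  if is_zero x then x = zero else le (succ zero) x.
Proof.
revert x; apply brw_ind.
- intro x; destruct (is_zero x); [intros p q; apply carrier_set | intros p q; apply le_prop].
- unfold is_zero; now rewrite s_zero.
- intros x _; unfold is_zero; rewrite s_succ; cbn; apply le_succ_mono, le_zero.
- intros f hf _; unfold is_zero; unshelve erewrite s_lim.
  + intro n; cbn; intro e.
    assert (h := s_le (brw_elim (is_zero_motive B)) (hf n) e).
    rewrite s_succ in h; exact h.
  + cbn; apply le_cocone with 1; apply (le_trans (y := succ (f 0))).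
    * apply le_succ_mono, le_zero.
    * apply hf.
Qed.

Definition zero_or_pos (B : Brw_spec) (x : B) : {x = zero} + {le (succ zero) x} :=
  (if is_zero x as b
      return (if b then x = zero else le (succ zero) x) -> {x = zero} + {le (succ zero) x}
   then fun h => left h else fun h => right h) (is_zeroP x).

Definition mul_motive (B : Brw_spec) (x : B) (hx : le (succ zero) x) : brw_motive B :=
  rec_motive (z := zero) (s := fun a => add a x)
    (fun a b p => le_add2r x p) (fun a _ => le_succ_add a hx).

Definition mul_pos (B : Brw_spec) (x : B) (hx : le (succ zero) x) (y : B) : B :=
  proj1_sig (brw_elim (mul_motive hx) y).

(** For [x = zero] the sequence [x * f n] is not increasing, so this case is
    treated separately; [zero_or_pos] decides it. *)
Definition mul (B : Brw_spec) (x y : B) : B :=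
  match zero_or_pos x with
  | left _ => zero
  | right hx => mul_pos hx y
  end.

Section MulTheory.
Variables (B : Brw_spec) (x : B).

Lemma mul_zero : mul x zero = zero.
Proof.
unfold mul, mul_pos; destruct (zero_or_pos x); [easy | now rewrite s_zero].
Qed.

Lemma mul_succ y : mul x (succ y) = add (mul x y) x.
Proof.
unfold mul; destruct (zero_or_pos x) as [-> | hx].
- symmetry; apply add_zero.
- unfold mul_pos at 1; now rewrite s_succ.
Qed.

Lemma le_mul2l y y' : le y y' -> le (mul x y) (mul x y').
Proof.
unfold mul; destruct (zero_or_pos x) as [_ | hx]; intro p.
- apply le_refl.
- exact (s_le (brw_elim (mul_motive hx)) p).
Qed.

Hypothesis hx : le (succ zero) x.

Lemma mul_increasing f : increasing f -> increasing (fun n => mul x (f n)).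
Proof.
intros hf n; apply (le_trans (le_succ_add _ hx)).
rewrite <- mul_succ; apply le_mul2l, hf.
Qed.

Lemma mul_lim f (hf : increasing f) :
  mul x (lim f hf) = lim (fun n => mul x (f n)) (mul_increasing hf).
Proof.
assert (E : forall y, mul x y = mul_pos hx y).
{ intro y; unfold mul; destruct (zero_or_pos x) as [e | hx'].
  - exfalso; assert (h := hx); rewrite e in h.
    assert (k := s_le (brw_elim (is_zero_motive B)) h); cbn in k.
    rewrite s_zero, s_succ in k; now discriminate k.
  - now rewrite (le_prop hx' hx). }
assert (I : forall n, le (add (mul_pos hx (f n)) x) (mul_pos hx (f (S n)))).
{ intro n; rewrite <- !E, <- mul_succ; apply le_mul2l, hf. }
rewrite E; unfold mul_pos; unshelve erewrite s_lim.
- exact I.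
- cbn; apply bisim; intro k; exists k; rewrite E; apply le_refl.
Qed.

End MulTheory.

Fixpoint of_nat (B : Brw_spec) (n : nat) : B :=
  match n with
  | 0 => zero
  | S m => succ (of_nat B m)
  end.

Definition omega (B : Brw_spec) : B :=
  lim (of_nat B) (fun n => le_refl (of_nat B (S n))).

Definition ord_decidable (B : Brw_spec) (alpha : B) (P : Prop) : Prop :=
  exists y : B, P <-> le alpha y.

(* Main.v *)
(** The proof is constructive: apart from countable choice it uses only
    propositional extensionality, which makes every [Prop] a proposition in the
    sense of HoTT.  A successor lies below a limit only if it lies below a term
    of the sequence, and sequences are strictly increasing, so
    [omega * (k + 1) <= lim f] holds exactly if [omega * k <= f n] for some [n].
    By countable choice, semidecidable propositions are closed under countable
    disjunction, and a limit is below [succ y] only if it is below [y]; so an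
    induction on [k] and then on [y] concludes. *)

Require Import Defs.
From Stdlib Require Import PropExtensionality.
From Stdlib Require Cantor.

Lemma semidecidable_iff (P Q : Prop) :
  (P <-> Q) -> semidecidable P -> semidecidable Q.
Proof. intros PQ [s hs]; exists s; tauto. Qed.

Lemma semidecidable_True : semidecidable True.
Proof. exists (fun _ => true); split; [now exists 0 | easy]. Qed.

Lemma semidecidable_False : semidecidable False.
Proof. exists (fun _ => false); split; [easy | now intros [_ e]]. Qed.

Lemma semidecidable_exists (cc : countable_choice) (P : nat -> Prop) :
  (forall n, semidecidable (P n)) -> semidecidable (exists n, P n).
Proof.
intro H.
(* Each [P n] only merely has a test sequence; choice picks all of them at once, so that Cantor
   pairing can search them in parallel. *)
destruct (cc (fun n => {s : nat -> bool | P n <-> exists i, s i = true})) as [s].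
{ intro n; destruct (H n) as [s hs]; now exists; exists s. }
exists (fun i => proj1_sig (s (fst (Cantor.of_nat i))) (snd (Cantor.of_nat i))); split.
- intros [n p]; apply (proj2_sig (s n)) in p as [i e].
  exists (Cantor.to_nat (n, i)); now rewrite Cantor.cancel_of_to.
- intros [i e]; exists (fst (Cantor.of_nat i)); apply (proj2_sig (s _)).
  now exists (snd (Cantor.of_nat i)).
Qed.

(** Fixing [x], this describes [succ x <= y] by recursion on [y]; the order
    [x <= y] may itself be used in the successor case. *)
Definition below_motive (B : Brw_spec) (x : B) : brw_motive B.
Proof.
unshelve refine (@Build_brw_motive B (fun _ => Prop)
  (fun _ _ _ P Q => P -> Q) _ False (fun y _ => le x y)
  (fun _ _ P _ => exists n, P n) _ _ _ _ _ _); cbn; auto.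
- intros _ P Q p q; apply proof_irrelevance.
- intros f g hf hg P Q _ _ fg gf PQ QP; rewrite rew_const.
  (* Mutually simulating families have equivalent disjunctions; extensionality makes them equal. *)
  apply propositional_extensionality; split; intros [k h].
  + destruct (PQ k) as (n & _ & i); exists n; auto.
  + destruct (QP k) as (n & _ & i); exists n; auto.
- easy.
- intros y z p _ _ _ q; exact (le_trans q p).
- intros y f hf k _ P Q _ h p; exists k; auto.
- intros y f hf _ P Q _ h [n p]; exact (h n p).
Defined.

Definition below (B : Brw_spec) (x y : B) : Prop := brw_elim (below_motive B x) y.

Section Below.
Variables (B : Brw_spec) (x : B).

Lemma below_zero : below B x zero = False.
Proof. exact (s_zero (brw_elim (below_motive B x))). Qed.

Lemma below_succ y : below B x (succ y) = le x y.
Proof. exact (s_succ (brw_elim (below_motive B x)) y). Qed.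

Lemma below_le y z : le y z -> below B x y -> below B x z.
Proof. intro p; exact (s_le (brw_elim (below_motive B x)) p). Qed.

Lemma below_lim f (hf : increasing f) :
  below B x (lim f hf) = exists n, below B x (f n).
Proof.
unfold below at 1; unshelve erewrite s_lim; [| reflexivity].
intros n; cbn; intro p; apply (below_le _ _ (hf n)); now rewrite below_succ.
Qed.

Lemma below_iff y : below B x y <-> le (succ x) y.
Proof.
split.
- revert y; apply (brw_ind (P := fun y => below B x y -> le (succ x) y)).
  + intros y p q; apply proof_irrelevance.
  + now rewrite below_zero.
  + intros y _; rewrite below_succ; apply le_succ_mono.
  + intros f hf IH; rewrite below_lim; intros [n p].
    apply le_cocone with n; auto.
(* Transport along [p] starts from [below B x (succ x)], which is reflexivity of [le]. *)
- intro p; apply (below_le _ _ p); rewrite below_succ; apply le_refl.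
Qed.

End Below.

Lemma not_le_succ_zero (B : Brw_spec) (x : B) : ~ le (succ x) zero.
Proof. now rewrite <- below_iff, below_zero. Qed.

Lemma le_succ_inv (B : Brw_spec) (x y : B) : le (succ x) (succ y) -> le x y.
Proof. now rewrite <- below_iff, below_succ. Qed.

Lemma le_succ_lim_inv (B : Brw_spec) (x : B) f (hf : increasing f) :
  le (succ x) (lim f hf) -> exists n, le (succ x) (f n).
Proof.
rewrite <- below_iff, below_lim; intros [n p].
exists n; now apply below_iff.
Qed.

Lemma le_lim (B : Brw_spec) (f : nat -> B) (hf : increasing f) n : le (f n) (lim f hf).
Proof. apply le_cocone with n, le_refl. Qed.

(** Strict increase gives [succ (f n) <= f (S n) <= succ y], and the successors cancel. *)
Lemma lim_le_succ_inv (B : Brw_spec) (f : nat -> B) (hf : increasing f) (y : B) :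
  le (lim f hf) (succ y) -> le (lim f hf) y.
Proof.
intro p; apply le_limiting; intro n; apply le_succ_inv.
exact (le_trans (hf n) (le_trans (le_lim B f hf (S n)) p)).
Qed.

Lemma not_lim_le_zero (B : Brw_spec) (f : nat -> B) (hf : increasing f) :
  ~ le (lim f hf) zero.
Proof.
intro p; apply (not_le_succ_zero B (f 0)).
exact (le_trans (hf 0) (le_trans (le_lim B f hf 1) p)).
Qed.

Lemma add_omega_le_lim (B : Brw_spec) (a : B) f (hf : increasing f) :
  le (add a (omega B)) (lim f hf) <-> exists n, le a (f n).
Proof.
unfold omega; rewrite add_lim; split.
(* [succ a] is the term of index 1 of the sequence with limit [a + omega]. *)
- intro p; destruct (le_succ_lim_inv B a f hf) as [n q].
  + refine (le_trans _ (le_trans (le_lim B _ _ 1) p)); cbn.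
    rewrite add_succ, add_zero; apply le_refl.
  + exists n; exact (le_trans (le_succ_self a) q).
(* Each step of [f] gains at least one successor, so [a + m <= f (m + n)]. *)
- intros [n p]; apply le_limiting; intro m; apply le_cocone with (m + n).
  induction m as [| m IH]; cbn.
  + now rewrite add_zero.
  + rewrite add_succ; exact (le_trans (le_succ_mono IH) (hf _)).
Qed.

Lemma semidecidable_omega_mul_le (cc : countable_choice) (B : Brw_spec) (k : nat) (y : B) :
  semidecidable (le (mul (omega B) (of_nat B k)) y).
Proof.
revert y; induction k as [| k IHk]; cbn.
{ intro y; rewrite mul_zero; apply semidecidable_iff with True.
  - split; [intros _; apply le_zero | easy].
  - apply semidecidable_True. }
rewrite mul_succ; apply brw_ind.
- intros y p q; apply proof_irrelevance.
- apply semidecidable_iff with False; [| apply semidecidable_False].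
  split; [easy |]; unfold omega at 2; rewrite add_lim; apply not_lim_le_zero.
- intro y; apply semidecidable_iff; split.
  + intro p; exact (le_trans p (le_succ_self y)).
  + unfold omega at 2 4; rewrite add_lim; apply lim_le_succ_inv.
- intros f hf _; eapply semidecidable_iff.
  + symmetry; apply add_omega_le_lim.
  (* The hypothesis on [k] holds for every ordinal, hence at each [f n]. *)
  + apply (semidecidable_exists cc); intro n; apply IHk.
Qed.

Theorem theorem8p3 (cc : countable_choice) (B : Brw_spec) (k : nat) (P : Prop) :
  ord_decidable (mul (omega B) (of_nat B k)) P -> semidecidable P.
Proof.
intros [y hy]; eapply semidecidable_iff.
- symmetry; exact hy.
- exact (semidecidable_omega_mul_le cc B k y).
Qed.
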